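(* Let $\widetilde{M}$ be a simply connected and complete Riemannian manifold. Let $k\geqslant 1$ and let $\Gamma$ be a discrete subgroup of isometries of $\widetilde{M}$ freely generated by elements $\gamma_1,\ldots,\gamma_k$. Then for any $\widetilde{x}\in\widetilde{M}$, $$ \sum_{i=1}^k \frac{1}{1+e^{\delta(\Gamma)\cdot d(\widetilde{x},\gamma_i\cdot\widetilde{x})}}\leqslant\frac{1}{2}, $$ where $\delta(\Gamma)$ denotes the critical exponent of $\Gamma$ and $d$ denotes the Riemannian distance on $\widetilde{M}$.
   Context: The critical exponent of $\Gamma$ is defined as the unique real number $\delta(\Gamma)$ such that the Poincaré series $\sum_{\gamma\in\Gamma}\exp(-s\,d(\widetilde{x},\gamma\cdot\widetilde{x}))$ converges for $s>\delta(\Gamma)$ and diverges for $s<\delta(\Gamma)$. It does not depend on the chosen point $\widetilde{x}\in\widetilde{M}$. Manifolds are connected. ''Freely generated by $\gamma_1,\ldots,\gamma_k$'' means that $\Gamma$ is a free group with basis $\gamma_1,\ldots,\gamma_k$. *)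

(* Defs.v *)
From HB Require Import structures.
From mathcomp Require Import all_boot all_order all_algebra.
From mathcomp Require Import all_classical all_reals all_analysis.

Set Implicit Arguments.
Unset Strict Implicit.
Unset Printing Implicit Defensive.

Import Order.TTheory GRing.Theory Num.Theory.
Import numFieldNormedType.Exports.

Local Open Scope classical_set_scope.
Local Open Scope ring_scope.

(* [U] is meant to be open: the values of [f] outside [U] are then irrelevant. *)
Fixpoint class_C (R : realType) (V W : normedModType R) (r : nat)
    (U : set V) (f : V -> W) : Prop :=
  (forall x, U x -> {for x, continuous f}) /\
  if r is r'.+1 then
    forall v, (forall x, U x -> derivable f x v) /\
              class_C r' U (fun x => 'D_v f x)
  else True.

Definition smooth_on (R : realType) (V W : normedModType R)
    (U : set V) (f : V -> W) : Prop := forall r, class_C r U f.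

Record chart (R : realType) (M : topologicalType) (n : nat) := Chart {
  chart_dom : set M ;
  chart_map : M -> 'rV[R]_n ;
  chart_inv : 'rV[R]_n -> M ;
  chart_dom_open : open chart_dom ;
  chart_im_open : open (chart_map @` chart_dom) ;
  chart_map_continuous : {within chart_dom, continuous chart_map} ;
  chart_inv_continuous :
    {within chart_map @` chart_dom, continuous chart_inv} ;
  chart_mapK : forall x, chart_dom x -> chart_inv (chart_map x) = x
}.

Definition chart_im (R : realType) (M : topologicalType) (n : nat)
    (a : chart R M n) : set 'rV[R]_n := chart_map a @` chart_dom a.

Definition overlap (R : realType) (M : topologicalType) (n : nat)
    (a b : chart R M n) : set 'rV[R]_n :=
  chart_map a @` (chart_dom a `&` chart_dom b).

Definition transition (R : realType) (M : topologicalType) (n : nat)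
    (a b : chart R M n) : 'rV[R]_n -> 'rV[R]_n :=
  chart_map b \o chart_inv a.

(* The atlas is indexed by the points of [M], with a chart around each point;
   charts may be repeated, and every smooth structure has such an atlas. *)
Record smooth_atlas (R : realType) (M : topologicalType) (n : nat) :=
  SmoothAtlas {
  chart_at :> M -> chart R M n ;
  chart_at_dom : forall p, chart_dom (chart_at p) p ;
  transition_smooth : forall p q,
    smooth_on (overlap (chart_at p) (chart_at q))
              (transition (chart_at p) (chart_at q))
}.

Definition bilin (R : realType) (n : nat) (G : 'M[R]_n) (u v : 'rV[R]_n) : R :=
  (u *m G *m v^T) 0 0.

(* [gram p x] is the Gram matrix of the metric tensor at the point of
   coordinates [x], in the coordinate basis of the chart [A p]. *)
Record riemannian_metric (R : realType) (M : topologicalType) (n : nat)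
    (A : smooth_atlas R M n) := RiemannianMetric {
  gram :> M -> 'rV[R]_n -> 'M[R]_n ;
  gram_smooth : forall p, smooth_on (chart_im (A p)) (gram p) ;
  gram_sym : forall p x, chart_im (A p) x -> (gram p x)^T = gram p x ;
  gram_pos : forall p x v, chart_im (A p) x -> v != 0 ->
    0 < bilin (gram p x) v v ;
  gram_transition : forall p q x, overlap (A p) (A q) x -> forall u v,
    let tau := transition (A p) (A q) in
    bilin (gram p x) u v = bilin (gram q (tau x)) ('D_u tau x) ('D_v tau x)
}.

Section riemannian_distance.
Variables (R : realType) (M : topologicalType) (n : nat).
Variables (A : smooth_atlas R M n) (g : riemannian_metric A).

Definition C1_at (c : R -> M) (t : R) : Prop :=
  let u := chart_map (A (c t)) \o c in
  [/\ {for t, continuous c},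
      \forall s \near t, derivable u s 1 &
      {for t, continuous (derive1 u)}].

(* C^1 up to the end points: on [a, b], [c] agrees with a curve which is C^1
   on both sides of [a] and of [b]. *)
Definition C1_between (c : R -> M) (a b : R) : Prop :=
  exists e : R -> M, forall t, t \in `[a, b] -> e t = c t /\ C1_at e t.

(* Only the restriction of [c] to [0, 1] matters; the subdivision is
   0 < s_0 < s_1 < ... with last term 1. *)
Definition piecewise_C1 (c : R -> M) : Prop :=
  exists s : seq R, [/\ path <%R 0 s, last 0 s = 1 &
    forall j, (j < size s)%N -> C1_between c (0 :: s)`_j s`_j].

(* The velocity is junk where [c] is not differentiable, that is, at finitely
   many times when [c] is piecewise C^1. *)
Definition speed (c : R -> M) (t : R) : R :=
  let u := chart_map (A (c t)) \o c in
  Num.sqrt (bilin (g (c t) (u t)) (derive1 u t) (derive1 u t)).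

Definition curve_length (c : R -> M) : \bar R :=
  (\int[lebesgue_measure]_(t in `[0%R, 1%R]) (speed c t)%:E)%E.

Definition riemannian_dist (x y : M) : \bar R :=
  ereal_inf [set curve_length c | c in
    [set c | [/\ piecewise_C1 c, c 0 = x & c 1 = y]]].

End riemannian_distance.

(* The metric space [M] is the manifold with its Riemannian distance. In
   particular the charts are homeomorphisms for the metric topology, so [M] is
   automatically Hausdorff and paracompact. *)
Definition is_riemannian (R : realType) (M : metricType R) (n : nat)
    (A : smooth_atlas R M n) (g : riemannian_metric A) : Prop :=
  forall x y : M, (mdist x y)%:E = riemannian_dist g x y.

(* For the Riemannian distance this is equivalent to geodesic completeness
   (Hopf-Rinow). *)
Definition metric_complete (R : realType) (M : metricType R) : Prop :=
  forall F : set_system M, ProperFilter F -> cauchy F ->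
    exists x : M, F --> x.

Definition path_connected (R : realType) (M : topologicalType) : Prop :=
  forall x y : M, exists f : R -> M,
    [/\ {within `[0, 1], continuous f}, f 0 = x & f 1 = y].

Definition null_homotopic (R : realType) (M : topologicalType)
    (f : R -> M) : Prop :=
  exists H : R * R -> M,
    [/\ {within `[0, 1] `*` `[0, 1], continuous H},
        forall t, t \in `[0, 1] -> H (0, t) = f t /\ H (1, t) = f 0 &
        forall s, s \in `[0, 1] -> H (s, 0) = f 0 /\ H (s, 1) = f 0].

Definition simply_connected (R : realType) (M : topologicalType) : Prop :=
  path_connected R M /\
  forall f : R -> M, {within `[0, 1], continuous f} -> f 0 = f 1 ->
    null_homotopic f.

(* Distance-preserving bijections. For the Riemannian distance these are exactly
   the diffeomorphisms preserving the metric tensor (Myers-Steenrod). *)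
Record isom (R : realType) (M : metricType R) := Isom {
  isom_fun :> M -> M ;
  isom_inv : M -> M ;
  isom_funK : cancel isom_fun isom_inv ;
  isom_invK : cancel isom_inv isom_fun ;
  isom_dist : forall x y,
    mdist (isom_fun x) (isom_fun y) = mdist x y
}.

Section isom_group.
Variables (R : realType) (M : metricType R).

Lemma isom_eq (f h : isom M) : f =1 h -> f = h.
Proof.
case: f h => [f f' fK f'K fd] [h h' hK h'K hd] /= /funext fh.
case: _ / fh in hK h'K hd *.
have fh' : f' = h' by apply/funext => x; rewrite -{1}(h'K x) fK.
case: _ / fh' in hK h'K *.
congr Isom; exact: Prop_irrelevance.
Qed.

Definition isom_one : isom M :=
  @Isom R M id id (fun=> erefl) (fun=> erefl) (fun _ _ => erefl).

Definition isom_mul (f h : isom M) : isom M :=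
  @Isom R M (f \o h) (isom_inv h \o isom_inv f)
    (can_comp (@isom_funK _ _ f) (@isom_funK _ _ h))
    (can_comp (@isom_invK _ _ h) (@isom_invK _ _ f))
    (fun x y => etrans (isom_dist f _ _) (isom_dist h x y)).

Lemma isom_inv_dist (f : isom M) x y :
  mdist (isom_inv f x) (isom_inv f y) = mdist x y.
Proof. by rewrite -(isom_dist f) !isom_invK. Qed.

Definition isom_opp (f : isom M) : isom M :=
  Isom (@isom_invK _ _ f) (@isom_funK _ _ f)
    (@isom_inv_dist f).

HB.instance Definition _ := gen_eqMixin (isom M).
HB.instance Definition _ := gen_choiceMixin (isom M).

Lemma isom_mulA : associative isom_mul.
Proof. by move=> f h l; apply: isom_eq. Qed.
Lemma isom_mul1 : left_id isom_one isom_mul.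
Proof. by move=> f; apply: isom_eq. Qed.
Lemma isom_mulr1 : right_id isom_one isom_mul.
Proof. by move=> f; apply: isom_eq. Qed.
Lemma isom_mulV : left_inverse isom_one isom_opp isom_mul.
Proof. by move=> f; apply: isom_eq => x; exact: isom_funK. Qed.
Lemma isom_mulVr : right_inverse isom_one isom_opp isom_mul.
Proof. by move=> f; apply: isom_eq => x; exact: isom_invK. Qed.

HB.instance Definition _ := isGroup.Build (isom M)
  isom_mulA isom_mul1 isom_mulr1 isom_mulV isom_mulVr.

HB.instance Definition _ := Topological.copy (isom M)
  (@initial_topology (isom M) {compact-open, M -> M} (@isom_fun R M)).

End isom_group.

Definition is_subgroup (G : groupType) (Gamma : set G) : Prop :=
  Gamma 1%g /\ forall a b, Gamma a -> Gamma b -> Gamma (a * b^-1)%g.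

(* On [isom M] the topology is the compact-open one. *)
Definition discrete_subset (T : topologicalType) (S : set T) : Prop :=
  forall x, S x -> isolated S x.

(* The letter (i, true) stands for the i-th generator and (i, false) for its
   inverse. *)
Definition word (k : nat) := seq ('I_k * bool).

Definition reduced (k : nat) (w : word k) : bool :=
  sorted (fun a b => ~~ ((a.1 == b.1) && (a.2 != b.2))) w.

Definition word_val (G : groupType) (k : nat) (gamma : 'I_k -> G)
    (w : word k) : G :=
  (\big[*%g/1%g]_(l <- w) (if l.2 then gamma l.1 else (gamma l.1)^-1))%g.

(* Evaluation is a bijection from the reduced words, that is, from the free
   group on k letters, onto [Gamma]. *)
Definition free_basis (G : groupType) (Gamma : set G) (k : nat)
    (gamma : 'I_k -> G) : Prop :=
  set_bij [set w : word k | reduced w] Gamma (word_val gamma).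

Definition poincare_series (R : realType) (M : metricType R)
    (Gamma : set (isom M)) (x : M) (s : R) : \bar R :=
  (\esum_(f in Gamma) (expR (- (s * mdist x (f x))))%:E)%E.

(* The terms are nonnegative, so divergence means that the sum is +oo. *)
Definition is_critical_exponent (R : realType) (M : metricType R)
    (Gamma : set (isom M)) (x : M) (delta : R) : Prop :=
  (forall s, delta < s -> (poincare_series Gamma x s < +oo)%E) /\
  (forall s, s < delta -> poincare_series Gamma x s = +oo%E).

(* Main.v *)
Require Import Defs.
From mathcomp Require Import all_boot all_order all_algebra.
From mathcomp Require Import all_classical all_reals all_analysis.
From mathcomp Require Import ring lra.

Import Order.TTheory GRing.Theory Num.Theory.
Import numFieldNormedType.Exports.
Local Open Scope classical_set_scope.
Local Open Scope ring_scope.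

(** The inequality is a comparison with a weighted word metric.  Put
    [l_i = d(x, gamma_i x)].  By the triangle inequality and the invariance of
    the distance, an element of [Gamma] with reduced word [w] moves [x] by at
    most the sum of the [l_i] over the letters of [w].  For [s >= 0] the Poincare
    series at [s] therefore dominates the sum over the reduced words of the
    multiplicative weight whose value on the letters [i] and [i^-1] is
    [a_i = exp (- s l_i)].

    That weighted sum is explicitly computable ([sum_reduced_words]).  If its
    value [S] is finite and [S_l] is the contribution of the words that begin
    with the letter [l], then
      [S_l = a_l (S - S_(l^-1))],  so  [S_l + S_(l^-1) = 2 a_l S / (1 + a_l)],
    and, on adding [1] for the empty word,
      [S = 1 + 2 S * \sum_i a_i / (1 + a_i)].
    Hence [\sum_i 1 / (1 + exp (s l_i)) < 1 / 2] whenever [s >= 0] and the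
    Poincare series converges at [s] ([critical_sum_lt]).  For [s = 0] the left
    side is [k / 2 >= 1 / 2], so the series diverges there and the critical
    exponent is nonnegative.  Letting [s] decrease to the critical exponent
    gives the theorem. *)

Lemma esumZl (R : realType) (T : choiceType) (I : set T) (f : T -> \bar R)
    (c : R) :
  0 < c -> (forall t, 0 <= f t)%E ->
  (\esum_(i in I) (c%:E * f i) = c%:E * \esum_(i in I) f i)%E.
Proof.
move=> c0 f0; rewrite /esum -ereal_sup_pZl//; congr ereal_sup.
apply/seteqP; split=> [_ [X IX <-]|_ [_ [X IX <-] <-]] /=.
  by exists (\sum_(i \in X) f i)%E; [exists X|rewrite ge0_mule_fsumr].
by exists X => //; rewrite ge0_mule_fsumr.
Qed.

Definition inv_letter {k : nat} (l : 'I_k * bool) : 'I_k * bool :=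
  (l.1, ~~ l.2).

Definition starts_with {k : nat} (l : 'I_k * bool) : set (word k) :=
  [set w | ohead w = Some l].

Lemma reduced_cons k (l : 'I_k * bool) (w : word k) :
  reduced (l :: w) = reduced w && (ohead w != Some (inv_letter l)).
Proof.
rewrite /reduced; case: w => [|m w] //=; rewrite andbC; congr andb.
case: l m => [i b] [j c]; rewrite /inv_letter /= (inj_eq Some_inj) xpair_eqE.
by rewrite [j == i]eq_sym; case: (i == j) b c => [] [] [].
Qed.

#[local] Arguments reduced : simpl never.

Lemma reduced_starts_with k (l : 'I_k * bool) :
  [set w : word k | reduced w] `&` starts_with l =
  cons l @` ([set w | reduced w] `&` ~` starts_with (inv_letter l)).
Proof.
apply/seteqP; split=> [[|m w] [rw]|_ [w [rw nw] <-]].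
- by [].
- by case=> <-; move: rw; rewrite /= reduced_cons => /andP[? /eqP]; exists w.
- by split=> //=; rewrite reduced_cons /= rw; apply/eqP.
Qed.

Section weighted_words.
Context {R : realType} {k : nat} (a : 'I_k -> R).
Hypothesis a_gt0 : forall i, 0 < a i.

Definition word_weight (w : word k) : R := \prod_(l <- w) a l.1.

Lemma word_weight_ge0 w : 0 <= word_weight w.
Proof. by apply: prodr_ge0 => l _; exact/ltW. Qed.

Definition total_weight : \bar R :=
  (\esum_(w in [set w | reduced w]) (word_weight w)%:E)%E.

Definition initial_weight (l : 'I_k * bool) : \bar R :=
  (\esum_(w in [set w | reduced w] `&` starts_with l) (word_weight w)%:E)%E.

Let weight_ge0 (w : word k) : (0 <= (word_weight w)%:E)%E.
Proof. by rewrite lee_fin word_weight_ge0. Qed.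

(** A reduced word is empty or has exactly one first letter. *)
Lemma total_weight_first_letter :
  (total_weight = 1 + \sum_(l : 'I_k * bool) initial_weight l)%E.
Proof.
rewrite /total_weight (esumID [set [::]])//; congr (_ + _)%E.
  have -> : [set w : word k | reduced w] `&` [set [::]] = [set [::]].
    by apply/seteqP; split=> [w []//|w /= ->].
  by rewrite esum_set1// /word_weight big_nil.
rewrite [LHS]esum_mkcondr -(eq_bigr _ (fun l _ => esym (esum_mkcondr _ _ _))).
rewrite -esum_sum; last by move=> w l _ _; case: ifP.
apply: eq_esum => -[|m w] _.
  rewrite big1 => [|l _]; first by rewrite memNset//=; apply.
  by rewrite memNset.
rewrite mem_set// (bigD1 m)//= mem_set// big1 ?adde0// => l lm.
by rewrite memNset// => -[] ml; rewrite ml eqxx in lm.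
Qed.

(** Deleting the first letter [l] leaves a reduced word that does not begin with
    the inverse of [l], and every such word occurs once.  Dividing by the weight
    of [l] avoids a subtraction of possibly infinite sums. *)
Lemma initial_weight_rec l :
  (total_weight = initial_weight (inv_letter l) +
     ((a l.1)^-1)%:E * initial_weight l)%E.
Proof.
rewrite /total_weight (esumID (starts_with (inv_letter l)))//.
congr (_ + _)%E; rewrite /initial_weight reduced_starts_with esum_image; last first.
  by move=> u v _ _ [].
rewrite -esumZl ?invr_gt0//; apply: eq_esum => w _.
by rewrite -EFinM /word_weight big_cons mulKf// gt_eqF.
Qed.

Lemma initial_weight_ge0 l : (0 <= initial_weight l)%E.
Proof. by apply: esum_ge0. Qed.

Lemma initial_weight_le l : (initial_weight l <= total_weight)%E.
Proof.
rewrite /total_weight (esumID (starts_with l))// leeDl//; exact: esum_ge0.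
Qed.

(** The letters [i] and [i^-1] have the same weight, and the two equations
    [initial_weight_rec] at these letters add up to a formula for the sum of the
    two initial weights. *)
Lemma sum_reduced_words : (total_weight < +oo)%E ->
  fine total_weight =
    1 + 2 * fine total_weight * \sum_(i < k) a i / (1 + a i).
Proof.
move=> Soo.
have Sge0 : (0 <= total_weight)%E by exact: esum_ge0.
have Sfin : total_weight \is a fin_num by rewrite ge0_fin_numE.
have ifin l : initial_weight l \is a fin_num.
  by rewrite ge0_fin_numE ?initial_weight_ge0// (le_lt_trans (initial_weight_le l)).
pose S := fine total_weight; pose T l := fine (initial_weight l).
have recS l : S = T (inv_letter l) + (a l.1)^-1 * T l.
  rewrite /S (initial_weight_rec l) fineD ?fineM//.
  by rewrite fin_numM.
have SE : S = 1 + \sum_(l : 'I_k * bool) T l.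
  rewrite /S total_weight_first_letter fineD ?sum_fine//.
  by apply/sum_fin_numP => l _ _; exact: ifin.
rewrite -/S [LHS]SE.
congr (1 + _); rewrite mulr_sumr.
rewrite (eq_bigr (fun l => T (l.1, l.2))); last by case.
rewrite -(pair_bigA _ (fun i b => T (i, b)))/=.
apply: eq_bigr => i _; rewrite big_bool.
have := recS (i, true); have := recS (i, false); rewrite /inv_letter/= -/S.
have := a_gt0 i; set b := a i; set p := T (i, true); set q := T (i, false).
move=> b0 E1 E2.
have F1 : b * S = b * p + q by rewrite E1; field; rewrite gt_eqF.
have F2 : b * S = b * q + p by rewrite E2; field; rewrite gt_eqF.
have -> : 2 * S * (b / (1 + b)) = (b * S + b * S) / (1 + b) by ring.
rewrite {1}F1 F2; field; rewrite gt_eqF// addr_gt0//.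
Qed.

(** The formula gives [(S - 1) / (2 S)] for this sum, where [S] is the total
    weight. *)
Lemma weight_sum_lt_half : (total_weight < +oo)%E ->
  \sum_(i < k) a i / (1 + a i) < 1 / 2.
Proof.
move=> Soo; have := sum_reduced_words Soo.
have : 0 <= fine total_weight by apply: fine_ge0; exact: esum_ge0.
set S := fine _; set F := \sum_(i < k) _ => S0 SE.
have {S0} S0 : 0 < S.
  rewrite lt_neqAle S0 andbT; apply/eqP => S0'.
  by move: SE; rewrite -S0'; lra.
rewrite -subr_gt0 -(pmulr_rgt0 _ S0); lra.
Qed.

End weighted_words.

Section displacement.
Context {R : realType} {M : metricType R}.

(** A product of isometries displaces [x] by at most the sum of the displacements
    of the factors, and an isometry displaces [x] as much as its inverse. *)
Lemma mdist_word_val k (gamma : 'I_k -> isom M) (x : M) (w : word k) :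
  mdist x (word_val gamma w x) <= \sum_(l <- w) mdist x (gamma l.1 x).
Proof.
elim: w => [|[i b] w IHw].
  by rewrite /word_val !big_nil/= mdistxx.
rewrite /word_val !big_cons -/(word_val gamma w) /=.
set f : isom M := if b then _ else _.
have -> : mdist x (gamma i x) = mdist x (f x).
  rewrite /f; case: b {f} => //.
  by rewrite -[RHS](isom_dist (gamma i)) metric_sym /= isom_invK.
apply: (le_trans (metric_triangle _ (f x) _)); rewrite lerD2l.
by rewrite (isom_dist f).
Qed.

Lemma mdist_isom_base (f : isom M) (o x : M) :
  mdist o (f o) <= 2 * mdist o x + mdist x (f x).
Proof.
have := metric_triangle o x (f o); have := metric_triangle x (f x) (f o).
rewrite (isom_dist f) [mdist x o]metric_sym; lra.
Qed.

(** The base point [o] of the series may differ from [x]; the change costs the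
    factor [exp (- s * 2 d(o, x))], which is harmless. *)
Lemma poincare_series_ge (Gamma : set (isom M)) k (gamma : 'I_k -> isom M)
    (o x : M) (s : R) :
  free_basis Gamma gamma -> 0 <= s ->
  ((expR (- (s * (2 * mdist o x))))%:E *
     total_weight (fun i => expR (- (s * mdist x (gamma i x)))) <=
   poincare_series Gamma o s)%E.
Proof.
move=> hfree s0.
rewrite /total_weight -esumZl ?expR_gt0// => [|w]; last first.
  by rewrite lee_fin word_weight_ge0// => i; exact: expR_gt0.
rewrite /poincare_series (reindex_esum _ _ _ _ hfree); apply: le_esum => w _.
rewrite -EFinM lee_fin /word_weight -expR_sum -expRD ler_expR.
rewrite sumrN -mulr_sumr -opprD -mulrDr lerN2 ler_wpM2l//.
apply: le_trans (mdist_isom_base (word_val gamma w) o x) _.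
by rewrite lerD2l mdist_word_val.
Qed.

(** With [a = exp (- s d)], the quotient [a / (1 + a)] is [1 / (1 + exp (s d))]. *)
Lemma critical_sum_lt (Gamma : set (isom M)) k (gamma : 'I_k -> isom M)
    (o x : M) (s : R) :
  free_basis Gamma gamma -> 0 <= s ->
  (poincare_series Gamma o s < +oo)%E ->
  \sum_(i < k) 1 / (1 + expR (s * mdist x (gamma i x))) < 1 / 2.
Proof.
move=> hfree s0 Poo.
pose a i := expR (- (s * mdist x (gamma i x))).
have a0 i : 0 < a i by exact: expR_gt0.
rewrite (eq_bigr (fun i => a i / (1 + a i))) => [|i _]; last first.
  rewrite /a expRN; have := expR_gt0 (s * mdist x (gamma i x)).
  by set e := expR _ => e0; field; rewrite !gt_eqF ?addr_gt0.
apply: weight_sum_lt_half => //.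
have := le_lt_trans (poincare_series_ge _ _ _ o x _ hfree s0) Poo.
rewrite -/a; case: (total_weight _) => [r _|| _] //; first exact: ltry.
by rewrite gt0_muley ?lte_fin ?expR_gt0.
Qed.

End displacement.

Theorem theorem1 (R : realType) (M : metricType R) (n : nat)
  (A : smooth_atlas R M n) (g : riemannian_metric A) (hM : is_riemannian g)
  (hcomplete : metric_complete M) (hsc : simply_connected R M)
  (k : nat) (hk : (1 <= k)%N)
  (Gamma : set (isom M)) (hGamma : is_subgroup Gamma)
  (hdiscrete : discrete_subset Gamma)
  (gamma : 'I_k -> isom M) (hfree : free_basis Gamma gamma)
  (o : M) (delta : R) (hdelta : is_critical_exponent Gamma o delta) (x : M) :
  \sum_(i < k) 1 / (1 + expR (delta * mdist x (gamma i x))) <= 1 / 2.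
Proof.
case: hdelta => conv _.
pose F s : R := \sum_(i < k) 1 / (1 + expR (s * mdist x (gamma i x))).
have lt_half s : 0 <= s -> delta < s -> F s < 1 / 2.
  by move=> s0 /conv; exact: critical_sum_lt.
(* at s = 0 every summand is 1 / 2, and there is at least one *)
have delta_ge0 : 0 <= delta.
  rewrite leNgt; apply/negP => /(lt_half _ (lexx 0)); apply/negP.
  rewrite -leNgt /F (eq_bigr (fun=> 1 / 2)) => [|i _]; last first.
    by rewrite mul0r expR0.
  by rewrite sumr_const card_ord -[leRHS]mulr_natr ler_peMr ?divr_ge0 ?ler1n.
have Fcont : F s @[s --> delta^'+] --> F delta.
  apply: cvg_at_right_filter.
  apply: cvg_big => [|i _]; first exact: add_continuous.
  apply: cvgM; first exact: cvg_cst.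
  apply: cvgV; first by rewrite gt_eqF// addr_gt0// expR_gt0.
  apply: cvgD; first exact: cvg_cst.
  apply: (@continuous_cvg _ _ _ _ _ (fun s => s * mdist x (gamma i x)) expR).
    exact: continuous_expR.
  by apply: cvgM; [exact: cvg_id|exact: cvg_cst].
apply: (cvgr_to_le Fcont); near=> s; apply/ltW/lt_half.
  by apply: (le_trans delta_ge0); near: s; exact: nbhs_right_ge.
by near: s; exact: nbhs_right_gt.
Unshelve. all: by end_near.
Qed.
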